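(* Let $n\ge 1$ be an integer, let $z_1,\dots,z_n\in\mathbb{C}$ (not necessarily distinct) satisfy $|z_1|=\dots=|z_n|=1$, and let $g_n(z)=\sum_{k=1}^n \frac{1}{z-z_k}$. Then for any such function $g_n$ and any $p>0$ we have $$\int_{-1}^1 |g_n(x)|^p\,dx>\int_{-1}^1 |g_n(x)|^p\,|x|^p\,dx>C_p\,n^{p-1},$$ where $$C_p:=\frac{3p^p(p+1)^{1-p}}{2^{p+5}(1+2p)^2}.$$
   Context: The function $g_n$ is the logarithmic derivative of a complex polynomial of degree $n$ all of whose zeros $z_1,\dots,z_n$ (counted with multiplicity) lie on the unit circle. The integrals are taken over the real segment $[-1,1]$, and $p$ is a real number.
   Formalization: The first strict inequality is stated as: strict, or both integrals equal +∞; when some z_k is 1 or −1 and p ≥ 1 both can diverge (e.g. n = 1, z_1 = 1, p = 1), so the literal strict inequality fails there. *)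

(* Defs.v *)
(* MathComp-Analysis; the complex numbers are R[i] over R : realType. *)
From mathcomp Require Import all_boot all_order all_algebra.
From mathcomp Require Import all_classical all_reals all_analysis.
From mathcomp Require Import complex.

Set Implicit Arguments.
Unset Strict Implicit.
Unset Printing Implicit Defensive.

Import Order.TTheory GRing.Theory Num.Theory.
Import numFieldNormedType.Exports.

Local Open Scope classical_set_scope.
Local Open Scope complex_scope.
Local Open Scope ring_scope.

Definition gsum (R : realType) (n : nat) (z : 'I_n -> R[i]) (w : R[i]) : R[i] :=
  \sum_(k < n) (w - z k)^-1.

(* The modulus as an element of R; the generic norm of R[i] takes values in R[i]. *)
Definition cabs (R : realType) (w : R[i]) : R := ComplexField.Normc.normc w.

(* Both integrals are Lebesgue integrals with values in [0, +oo]. They are +oo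
   when 1 <= p and some z k is 1 or -1; the integrand at such an endpoint is an
   irrelevant junk value, since inversion is total. *)
Definition intg (R : realType) (n : nat) (z : 'I_n -> R[i]) (p : R) : \bar R :=
  (\int[@lebesgue_measure R]_(x in `[(-1)%R, 1%R]) (cabs (gsum z x%:C) `^ p)%R%:E)%E.

Definition intgx (R : realType) (n : nat) (z : 'I_n -> R[i]) (p : R) : \bar R :=
  (\int[@lebesgue_measure R]_(x in `[(-1)%R, 1%R])
     (cabs (gsum z x%:C) `^ p * `|x| `^ p)%R%:E)%E.

Definition Cconst (R : realType) (p : R) : R :=
  (3 * p `^ p * (p + 1) `^ (1 - p)) / (2 `^ (p + 5) * (1 + 2 * p) ^+ 2).

(* Main.v *)
Require Import Defs.
From mathcomp Require Import all_boot all_order all_algebra.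
From mathcomp Require Import all_classical all_reals all_analysis.
From mathcomp Require Import complex measurable_realfun ring lra.

(** Put S(x) for the sum over k of the Poisson kernels (1 - x^2) / |x - z_k|^2.
    Since |z_k| = 1, the real part of x / (x - z_k) is (1 - kernel) / 2, so
    Re (x g(x)) = (n - S(x)) / 2, and |g(x)| |x| is at least |n - S(x)| / 2.  It
    is therefore enough to show that S stays away from its mean value n on a set
    of measure of order 1 / n.

    The reason is that S is built from n point masses, each of weight 1, and at
    distance about 1 / n from the point 1 a single mass is visible.  Fix L <= 1
    <= H, write x = 1 - t and d = 1 / (n H).  If some z_k is within d / 2 of 1,
    its kernel alone is at least 1 / t >= n H for t in [d / 2, d]
    ([poisson_near_pole]).  Otherwise every kernel is increasing enough near
    t = 0: with s = d / 4, no kernel is smaller on [s, 2 s] than at s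
    ([poisson_le_double]), while for t <= s it is at most
    (4 / 3) (t / s) times its value at s ([poisson_le_linear]).  So if S >= n H
    at s, then S >= n H on [s, 2 s]; if not, then S <= n L for
    t <= (3 / 4) s L / H.  In every case S <= n L or S >= n H on an interval of
    length (3 / 16) L / (n H^2) ([poisson_sum_deviates]).

    Taking 1 - L = H - 1 = p / (p + 1) and integrating the resulting bound
    |g(x)| |x| >= n p / (2 (p + 1)) over that interval gives twice the constant
    C_p n^(p-1).  The same interval, halved to keep away from 1, shows
    that the integral of |g|^p (1 - |x|^p) is positive, hence the strictness
    of the first inequality whenever the smaller integral is finite. *)

Import Order.TTheory GRing.Theory Num.Theory.

Local Open Scope complex_scope.
Local Open Scope ring_scope.

(** * The Poisson kernel along the radius ending at 1 *)

(** For |zeta| = 1 and c = |1 - zeta|^2 this is |1 - t - zeta|^2. *)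
Definition poisson_den (R : realFieldType) (c t : R) : R := t ^+ 2 + (1 - t) * c.

(** The Poisson kernel (1 - x^2) / |x - zeta|^2 at x = 1 - t, with
    c = |1 - zeta|^2 as only trace of the boundary point zeta. *)
Definition poisson (R : realFieldType) (c t : R) : R :=
  t * (2 - t) / poisson_den R c t.
Arguments poisson_den {R}.
Arguments poisson {R}.

Lemma poisson_den_gt0 (R : realFieldType) (c t : R) :
  0 < t <= 1 -> 0 <= c -> 0 < poisson_den c t.
Proof.
move=> /andP[t0 t1] c0; rewrite /poisson_den ltr_wpDr ?exprn_gt0//.
by rewrite mulr_ge0// subr_ge0.
Qed.

Lemma poisson_den_gt0_off_pole (R : realFieldType) (c t : R) :
  0 <= t < 1 -> 0 < c -> 0 < poisson_den c t.
Proof.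
move=> /andP[t0 t1] c0; rewrite /poisson_den ltr_wpDl ?exprn_ge0//.
by rewrite mulr_gt0// subr_gt0.
Qed.

Lemma poisson_ge0 (R : realFieldType) (c t : R) :
  0 < t <= 1 -> 0 <= c -> 0 <= poisson c t.
Proof.
move=> /[dup] /andP[t0 t1] t01 c0.
by rewrite divr_ge0 ?(ltW (poisson_den_gt0 _ _ _ t01 c0))// mulr_ge0//; lra.
Qed.

(** At c = t^2 the kernel equals 1 / t exactly: the denominator is then
    t^2 (2 - t).  Moving zeta closer to 1 only makes the kernel larger. *)
Lemma poisson_near_pole (R : realFieldType) (c t : R) :
  0 < t <= 1 -> 0 <= c <= t ^+ 2 -> t^-1 <= poisson c t.
Proof.
move=> /[dup] /andP[t0 t1] t01 /andP[c0 ct].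
have d0 := poisson_den_gt0 _ _ _ t01 c0.
rewrite /poisson ler_pdivlMr// mulrC ler_pdivrMr// /poisson_den.
have : (1 - t) * c <= (1 - t) * t ^+ 2 by rewrite ler_wpM2l// subr_ge0.
nra.
Qed.

(** The kernel increases until t is about the distance sqrt c from 1 to zeta.
    Comparing two points instead of differentiating gives the range up to
    t = 2 s, which is all of [s, sqrt c] when sqrt c = 2 s. *)
Lemma poisson_le_double (R : realFieldType) (c s t : R) :
  0 < s -> s <= t <= 2 * s -> t <= 1 -> (2 * s) ^+ 2 <= c ->
  poisson c s <= poisson c t.
Proof.
move=> s0 /andP[st t2s] t1 sc.
have c0 : 0 <= c by apply: le_trans sc; exact: sqr_ge0.
have ds : 0 < poisson_den c s by apply: poisson_den_gt0 => //; lra.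
have dt : 0 < poisson_den c t by apply: poisson_den_gt0 => //; lra.
rewrite /poisson ler_pdivrMr// mulrAC ler_pdivlMr// -subr_ge0.
(* Cross-multiplied, both sides agree at t = s, hence the factor t - s. *)
have -> : t * (2 - t) * poisson_den c s - s * (2 - s) * poisson_den c t =
  (t - s) * (c + c * ((1 - t) * (1 - s)) - 2 * t * s).
  by rewrite /poisson_den; ring.
apply: mulr_ge0; first lra.
have : 0 <= c * ((1 - t) * (1 - s)) by rewrite !mulr_ge0//; lra.
have : t * s <= 2 * s * s by rewrite ler_wpM2r// ltW.
nra.
Qed.

(** Far from its pole the kernel vanishes linearly at t = 0: for t <= s the
    denominator varies only between multiples of c, since s^2 <= c / 4.
    The bound s <= 1/4 serves to keep the loss (5/4 - s) / (1 - s) below 4/3. *)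
Lemma poisson_le_linear (R : realFieldType) (c s t : R) :
  0 < s <= 4^-1 -> 0 <= t <= s -> (2 * s) ^+ 2 <= c ->
  poisson c t <= 4 / 3 * (t / s) * poisson c s.
Proof.
move=> /andP[s0 s4] /andP[t0 ts] sc.
have c0 : 0 < c by apply: lt_le_trans sc; rewrite exprn_gt0//; lra.
have ds : 0 < poisson_den c s by apply: poisson_den_gt0_off_pole=> //; lra.
have dt : 0 < poisson_den c t by apply: poisson_den_gt0_off_pole => //; lra.
rewrite /poisson.
have -> : 4 / 3 * (t / s) * (s * (2 - s) / poisson_den c s) =
   t * (4 / 3 * (2 - s) / poisson_den c s).
  by field; rewrite !gt_eqF.
rewrite -[leLHS]mulrA ler_wpM2l// ler_pdivrMr// mulrAC ler_pdivlMr//.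
have h1 : poisson_den c s <= c * (5 / 4 - s) by rewrite /poisson_den; nra.
have h2 : c * (1 - t) <= poisson_den c t by rewrite /poisson_den; nra.
apply: (@le_trans _ _ ((2 - t) * (c * (5 / 4 - s)))).
  by rewrite ler_wpM2l//; lra.
apply: (@le_trans _ _ (4 / 3 * (2 - s) * (c * (1 - t)))); last first.
  by rewrite ler_wpM2l//; lra.
suff : (2 - t) * (5 / 4 - s) <= 4 / 3 * (2 - s) * (1 - t) by nra.
nra.
Qed.

(** * Deviation of a sum of Poisson kernels from its mean *)

(** A sum of n kernels cannot stay close to n at distance about 1 / n from the
    boundary: there either a single pole dominates, or no pole is near and the
    sum grows with t.  The dichotomy is on whether some pole lies within d / 2 of
    1, where d = 1 / (n H) is the distance at which one kernel reaches n H. *)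
Lemma poisson_sum_deviates (R : realFieldType) (n : nat) (c : 'I_n -> R) (L H : R) :
  (1 <= n)%N -> (forall k, 0 <= c k) -> 0 < L <= 1 -> 1 <= H ->
  exists2 a : R, 0 <= a <= 2^-1 & forall t,
    a <= t <= a + 3 / 16 * L / (n%:R * H ^+ 2) ->
    [/\ 0 <= t <= 1, forall k, 0 < poisson_den (c k) t &
     \sum_k poisson (c k) t <= n%:R * L \/
     n%:R * H <= \sum_k poisson (c k) t].
Proof.
move=> n1 c0 /andP[L0 L1] H1.
have n1R : 1 <= n%:R :> R by rewrite ler1n.
have nH0 : 1 <= n%:R * H by rewrite -[leLHS]mulr1 ler_pM.
set d := (n%:R * H)^-1.
have d0 : 0 < d by rewrite invr_gt0; lra.
have d1 : d <= 1 by rewrite invf_le1//; lra.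
set l := _ / _ in |- *.
have lE : l = 3 / 16 * d * (L / H).
  by rewrite /l /d; field; apply/andP; split; lra.
have LH1 : L / H <= 1 by rewrite ler_pdivrMr; lra.
have LH0 : 0 < L / H by rewrite divr_gt0//; lra.
have l0 : 0 < l by rewrite lE -mulrA; have := mulr_gt0 d0 LH0; lra.
have ld : l <= 3 / 16 * d by rewrite lE ler_piMr//; lra.
have [[k ck]|far] := pselect (exists k, c k <= (d / 2) ^+ 2).
  exists (d / 2); first by lra.
  move=> t /andP[dt td]; have t01 : 0 < t <= 1 by lra.
  split; [lra | by move=> j; exact: poisson_den_gt0 | right].
  rewrite (bigD1 k)//=; apply: (@le_trans _ _ (poisson (c k) t)); last first.
    by rewrite lerDl sumr_ge0// => j _; exact: poisson_ge0.
  apply: (@le_trans _ _ t^-1); last first.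
    apply: poisson_near_pole => //; rewrite c0/=.
    by apply: (le_trans ck); rewrite ler_pXn2r// nnegrE; lra.
  by rewrite -[n%:R * H]invrK lef_pV2 ?posrE -/d; lra.
set s := d / 4.
have s0 : 0 < s by rewrite /s; lra.
have cs k : (2 * s) ^+ 2 <= c k.
  have -> : 2 * s = d / 2 by rewrite /s; field.
  by rewrite leNgt; apply/negP => /ltW ck; apply: far; exists k.
have cgt0 k : 0 < c k by apply: lt_le_trans (cs k); rewrite exprn_gt0//; lra.
have [big|small] := leP (n%:R * H) (\sum_k poisson (c k) s).
  exists s; first by rewrite /s; lra.
  move=> t /andP[st tl]; have t2s : t <= 2 * s by rewrite /s in st tl *; lra.
  have t1 : t < 1 by rewrite /s in t2s; lra.
  split; [lra | by move=> k; apply: poisson_den_gt0_off_pole=> //; lra | right].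
  apply: (le_trans big); apply: ler_sum => k _.
  by apply: poisson_le_double => //; lra.
exists 0; first lra.
rewrite add0r => t /andP[t0 tl].
have ts : t <= s by rewrite /s; lra.
have s4 : s <= 4^-1 by rewrite /s; lra.
split; [lra | by move=> k; apply: poisson_den_gt0_off_pole=> //; lra | left].
apply: (@le_trans _ _ (4 / 3 * (t / s) * \sum_k poisson (c k) s)).
  rewrite mulr_sumr; apply: ler_sum => k _.
  by apply: poisson_le_linear => //; lra.
apply: (@le_trans _ _ (4 / 3 * (t / s) * (n%:R * H))).
  by apply: ler_wpM2l; [rewrite !mulr_ge0// invr_ge0; lra | exact: ltW].
have ls : 4 / 3 * (l / s) = L / H.
  by rewrite lE /s; field; apply/andP; split; rewrite gt_eqF//; lra.
apply: (@le_trans _ _ (4 / 3 * (l / s) * (n%:R * H))).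
  by rewrite ler_wpM2r ?ler_wpM2l ?ler_pM2r ?invr_gt0//; lra.
by rewrite ls mulrCA divfK// gt_eqF//; lra.
Qed.

(** * From the logarithmic derivative to Poisson kernels *)

Lemma Re_sum (R : realType) (n : nat) (w : 'I_n -> R[i]) :
  complex.Re (\sum_k w k) = \sum_k complex.Re (w k).
Proof. exact: (raddf_sum (@complex.Re R)). Qed.

Lemma Im_sum (R : realType) (n : nat) (w : 'I_n -> R[i]) :
  complex.Im (\sum_k w k) = \sum_k complex.Im (w k).
Proof. exact: (raddf_sum (@complex.Im R)). Qed.

Lemma Re_gsum (R : realType) (n : nat) (z : 'I_n -> R[i]) (x : R) :
  complex.Re (gsum z x%:C) = \sum_k (x - complex.Re (z k)) /
    ((x - complex.Re (z k)) ^+ 2 + complex.Im (z k) ^+ 2).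
Proof.
rewrite Re_sum; apply: eq_bigr => k _.
by case: (z k) => a b /=; rewrite sub0r sqrrN.
Qed.

Lemma Im_gsum (R : realType) (n : nat) (z : 'I_n -> R[i]) (x : R) :
  complex.Im (gsum z x%:C) = \sum_k complex.Im (z k) /
    ((x - complex.Re (z k)) ^+ 2 + complex.Im (z k) ^+ 2).
Proof.
rewrite Im_sum; apply: eq_bigr => k _.
by case: (z k) => a b /=; rewrite sub0r sqrrN mulNr opprK.
Qed.

Lemma cabsE (R : realType) (w : R[i]) :
  cabs w = Num.sqrt (complex.Re w ^+ 2 + complex.Im w ^+ 2).
Proof. by case: w. Qed.

Lemma normr_Re_le_cabs (R : realType) (w : R[i]) : `|complex.Re w| <= cabs w.
Proof. by rewrite cabsE -sqrtr_sqr ler_wsqrtr// lerDl sqr_ge0. Qed.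

(** Each term is Re (x / (x - zeta)) = (1 - kernel) / 2, because
    2 x (x - Re zeta) = |x - zeta|^2 - (1 - x^2) on the unit circle. *)
Lemma mulx_Re_gsum (R : realType) (n : nat) (z : 'I_n -> R[i]) (t : R)
    (c := fun k => 2 * (1 - complex.Re (z k))) :
  (forall k, cabs (z k) = 1) -> (forall k, 0 < poisson_den (c k) t) ->
  (1 - t) * complex.Re (gsum z (1 - t)%:C) =
  (n%:R - \sum_k poisson (c k) t) / 2.
Proof.
move=> z1 den0; rewrite Re_gsum mulr_sumr mulrBl mulr_suml.
have -> : n%:R / 2 = \sum_(k < n) 2^-1 :> R.
  by rewrite sumr_const card_ord mulr_natl.
rewrite -sumrB; apply: eq_bigr => k _.
have := den0 k; have := z1 k; rewrite cabsE /poisson /poisson_den /c.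
case: (z k) => a b /= ab1 d0.
have {}ab1 : b ^+ 2 = 1 - a ^+ 2.
  have := congr1 (fun x => x ^+ 2) ab1; rewrite sqr_sqrtr; last first.
    by rewrite addr_ge0 ?sqr_ge0.
  by rewrite expr1n => <-; ring.
rewrite ab1; have -> : (1 - t - a) ^+ 2 + (1 - a ^+ 2) =
  t ^+ 2 + (1 - t) * (2 * (1 - a)) by ring.
by field; rewrite gt_eqF.
Qed.

(** The thresholds L = 1 - m and H = 1 + m are those for which both sides of the
    dichotomy on S mean |n - S| >= n m. *)
Lemma cabs_gsum_large (R : realType) (n : nat) (z : 'I_n -> R[i]) (m : R) :
  (1 <= n)%N -> (forall k, cabs (z k) = 1) -> 0 < m < 1 ->
  exists2 b : R, 2^-1 <= b <= 1 & forall x,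
    b - 3 / 16 * (1 - m) / (n%:R * (1 + m) ^+ 2) <= x <= b ->
    0 <= x <= 1 /\ n%:R * m / 2 <= cabs (gsum z x%:C) * `|x|.
Proof.
move=> n1 z1 /andP[m0 m1].
pose c k := 2 * (1 - complex.Re (z k)).
have c0 k : 0 <= c k.
  have : complex.Re (z k) <= 1.
    by rewrite -(z1 k); apply: le_trans (normr_Re_le_cabs _ _); exact: ler_norm.
  by rewrite /c; lra.
have L01 : 0 < 1 - m <= 1 by lra.
have H1 : 1 <= 1 + m by lra.
have [a a01 aP] := poisson_sum_deviates _ _ _ _ _ n1 c0 L01 H1.
exists (1 - a); first lra.
move=> x xI; have tI : a <= 1 - x <= a + 3 / 16 * (1 - m) / (n%:R * (1 + m) ^+ 2).
  by lra.
have [t01 den0 S] := aP _ tI; split; first lra.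
apply: (@le_trans _ _ (`|complex.Re (gsum z x%:C)| * `|x|)); last first.
  by rewrite ler_wpM2r// normr_Re_le_cabs.
have := mulx_Re_gsum _ _ _ _ z1 den0; rewrite subKr => xRe.
rewrite -normrM (mulrC _ x) xRe normrM (@ger0_norm _ 2^-1) ?invr_ge0//.
rewrite ler_wpM2r ?invr_ge0//.
have n0 : 0 <= n%:R :> R by [].
case: S => S; rewrite ler_normr; apply/orP; [left|right]; nra.
Qed.

(** * Integration *)

(** Inverses of nonnegative reals and square roots are written as real powers,
    whose measurability covers the poles as well. *)
Lemma measurable_cabs_gsum (R : realType) (n : nat) (z : 'I_n -> R[i]) :
  measurable_fun setT (fun x : R => cabs (gsum z x%:C)).
Proof.
have mden (u v : R) : measurable_fun setT (fun x : R => ((x - u) ^+ 2 + v ^+ 2)^-1).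
  rewrite (_ : (fun _ => _) = (fun x => ((x - u) ^+ 2 + v ^+ 2) `^ (-1))).
    apply: (measurableT_comp (measurable_powR _)).
    by apply: measurable_funD => //; apply: measurable_funX; exact: measurable_funB.
  by apply/funext => x; rewrite powR_inv1// addr_ge0 ?sqr_ge0.
rewrite (_ : (fun _ => _) = (fun x : R => (complex.Re (gsum z x%:C) ^+ 2 +
   complex.Im (gsum z x%:C) ^+ 2) `^ 2^-1)); last first.
  by apply/funext => x; rewrite cabsE powR12_sqrt// addr_ge0 ?sqr_ge0.
apply: (measurableT_comp (measurable_powR _)).
apply: measurable_funD; apply: measurable_funX.
  under eq_fun do rewrite Re_gsum.
  by apply: measurable_sum => k; apply: measurable_funM => //; exact: measurable_funB.
under eq_fun do rewrite Im_gsum.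
by apply: measurable_sum => k; apply: measurable_funM.
Qed.

Lemma integral_ge_itv (R : realType) (D : set R) (f : R -> R) (a b e : R) :
  measurable D -> measurable_fun setT f -> (forall x, D x -> 0 <= f x) -> a <= b ->
  (`[a, b] `<=` D)%classic -> 0 <= e -> (forall x, a <= x <= b -> e <= f x) ->
  ((e * (b - a))%:E <= \int[lebesgue_measure]_(x in D) (f x)%:E)%E.
Proof.
move=> mD mf f0 ab abD e0 ef.
have mfE (A : set R) : measurable_fun A (EFin \o f).
  by apply/measurable_EFinP; exact: measurable_funTS.
apply: (@le_trans _ _ (\int[lebesgue_measure]_(x in `[a, b]) (f x)%:E)%E); last first.
  by apply: ge0_subset_integral => //; exact: mfE.
have -> : (e * (b - a))%:E = (\int[@lebesgue_measure R]_(x in `[a, b]) e%:E)%E.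
  rewrite integral_cst//= lebesgue_measure_itv/= lte_fin.
  case: ltP => [//|ba]; have -> : b = a by apply/le_anti; rewrite ba ab.
  by rewrite subrr mulr0 mule0.
by apply: ge0_le_integral => //=; exact: mfE.
Qed.

(** The left side is the bound n m / 2 to the power p, times the length of the
    interval given by [cabs_gsum_large], at m = p / (p + 1).  This m maximizes
    m^p (1 - m), the factor that matters when p is large. *)
Lemma powR_mul_length_CconstE (R : realType) (n : nat) (p : R) :
  (1 <= n)%N -> 0 < p ->
  (n%:R * (p / (p + 1)) / 2) `^ p *
    (3 / 16 * (1 - p / (p + 1)) / (n%:R * (1 + p / (p + 1)) ^+ 2)) =
  2 * (Cconst p * n%:R `^ (p - 1)).
Proof.
move=> n1 p0; have n0 : 0 < n%:R :> R by rewrite ltr0n.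
have p10 : 0 < p + 1 by lra.
rewrite /Cconst !powRM ?invr_ge0 ?mulr_ge0 ?invr_ge0 ?(ltW n0) ?(ltW p10) ?(ltW p0)//.
have -> : 2 `^ (p + 5) = 2 `^ p * 32 :> R.
  by rewrite powRD ?pnatr_eq0 ?implybT// (powR_mulrn 5)//; congr (_ * _); ring.
have -> : (p + 1) `^ (1 - p) = (p + 1) / (p + 1) `^ p.
  by rewrite powRD ?(gt_eqF p10) ?implybT// powRN powRr1// ltW.
rewrite -(mulr_powRB1 (ltW n0) p0).
have powRV (a : R) : 0 <= a -> a^-1 `^ p = (a `^ p)^-1.
  by move=> a0; rewrite -powR_inv1// -powRrM mulN1r powRN.
rewrite !powRV// ?(ltW p10)//.
have : 0 < (p + 1) `^ p by rewrite powR_gt0.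
have : 0 < 2 `^ p :> R by rewrite powR_gt0.
move: ((p + 1) `^ p) (2 `^ p) (p `^ p) (n%:R `^ (p - 1)) => A B C D B0 A0.
field; rewrite !gt_eqF//; lra.
Qed.

Theorem theorem1 (R : realType) (n : nat) (z : 'I_n -> R[i]) (p : R)
    (hn : (1 <= n)%N) (hz : forall k : 'I_n, cabs (z k) = 1) (hp : 0 < p) :
  ((intgx z p < intg z p)%E \/ (intg z p = +oo%E /\ intgx z p = +oo%E)) /\
  ((Cconst p * n%:R `^ (p - 1))%:E < intgx z p)%E.
Proof.
have n0 : 0 < n%:R :> R by rewrite ltr0n.
have p10 : 0 < p + 1 by lra.
set m := p / (p + 1).
have m01 : 0 < m < 1 by rewrite divr_gt0//= ltr_pdivrMr; lra.
have [b b01 bP] := cabs_gsum_large _ _ _ _ hn hz m01.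
set l := _ / _ in bP.
have l0 : 0 < l by rewrite divr_gt0 ?mulr_gt0 ?exprn_gt0//; lra.
pose e := (n%:R * m / 2) `^ p.
have nm0 : 0 < n%:R * m / 2 by rewrite divr_gt0// mulr_gt0//; case/andP: m01.
have e0 : 0 < e by rewrite powR_gt0.
pose G (x : R) := cabs (gsum z x%:C).
have G0 x : 0 <= G x by rewrite /G cabsE sqrtr_ge0.
have mG : measurable_fun setT (fun x => G x `^ p).
  by apply: (measurableT_comp (measurable_powR _)); exact: measurable_cabs_gsum.
have mX : measurable_fun setT (fun x : R => `|x| `^ p).
  by apply: (measurableT_comp (measurable_powR _)); exact: normr_measurable.
have Ge x : b - l <= x <= b -> e <= G x `^ p * `|x| `^ p.
  move=> /bP[_ Gx]; rewrite -powRM//.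
  by apply: ge0_ler_powR => //; rewrite ?nnegrE ?(ltW hp) ?(ltW nm0) ?mulr_ge0.
have sub u v : b - l <= u -> v <= b -> (`[u, v] `<=` `[(-1)%R, 1%R])%classic.
  move=> lu vb x /=; rewrite !in_itv/= => /andP[ux xv].
  by have /bP[x01 _] : b - l <= x <= b; lra.
split; last first.
  apply: (@lt_le_trans _ _ (e * (b - (b - l)))%:E).
    rewrite lte_fin subKr powR_mul_length_CconstE//.
    suff : 0 < Cconst p * n%:R `^ (p - 1) by lra.
    by rewrite /Cconst !(mulr_gt0, invr_gt0, powR_gt0, exprn_gt0)//; lra.
  apply: integral_ge_itv => //; [exact: measurable_funM | | lra | exact: sub | exact: ltW].
  by move=> x _; rewrite mulr_ge0 ?powR_ge0.
have p1 : 1 `^ p = 1 :> R by rewrite powR1.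
pose F (x : R) := G x `^ p * (1 - `|x| `^ p).
have mF : measurable_fun setT F.
  by apply: measurable_funM => //; exact: measurable_funB.
have F0 x : `[(-1)%R, 1%R]%classic x -> 0 <= F x.
  rewrite /= in_itv/= => x1; rewrite mulr_ge0 ?powR_ge0// subr_ge0.
  rewrite -[leRHS]p1.
  by apply: ge0_ler_powR; rewrite ?nnegrE ?ler_norml// ltW.
have gE : intg z p =
    (intgx z p + \int[@lebesgue_measure R]_(x in `[(-1)%R, 1%R]) (F x)%:E)%E.
  rewrite /intg /intgx -ge0_integralD//=; first last.
  - by apply/measurable_EFinP; exact: measurable_funTS.
  - by apply/measurable_EFinP; apply: measurable_funTS; exact: measurable_funM.
  - by move=> x _; rewrite lee_fin mulr_ge0 ?powR_ge0.
  by apply: eq_integral => x _; rewrite -EFinD /F mulrBr mulr1 addrC subrK.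
(* Halving the interval keeps it away from 1, where the weight 1 - |x|^p vanishes. *)
pose w := b - l / 2; pose e' := e * (1 - w `^ p).
have w0 : 0 <= w by have /bP[] : b - l <= w <= b; rewrite /w; lra.
have w1 : w < 1 by rewrite /w; lra.
have wp1 : w `^ p < 1.
  by rewrite -[ltRHS]p1; apply: gt0_ltr_powR; rewrite ?nnegrE.
have e'0 : 0 < e' by rewrite mulr_gt0// subr_gt0.
have Fpos : (0 < \int[@lebesgue_measure R]_(x in `[(-1)%R, 1%R]) (F x)%:E)%E.
  apply: (@lt_le_trans _ _ (e' * (w - (b - l)))%:E).
    by rewrite lte_fin mulr_gt0// /w; lra.
  apply: integral_ge_itv => //; [rewrite /w; lra | by apply: sub; rewrite /w; lra | exact: ltW |].
  move=> x /andP[lx xw]; have xb : b - l <= x <= b by rewrite /w in xw; lra.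
  have [x01 _] := bP _ xb; have xp : x `^ p <= w `^ p.
    by apply: ge0_ler_powR; rewrite ?nnegrE//; lra.
  rewrite /F ger0_norm; last lra.
  apply: ler_pM; rewrite ?subr_ge0 ?(ltW wp1) ?(ltW e0)//; last lra.
  apply: le_trans (Ge _ xb) _; rewrite ler_piMr ?powR_ge0// ger0_norm; lra.
have [xfin|] := ltP (intgx z p) +oo%E; last first.
  rewrite leye_eq => /eqP xoo; right; rewrite gE xoo; split => //.
  by rewrite addye// gt_eqF// (lt_trans _ Fpos).
left; rewrite gE lteDl// ge0_fin_numE//.
by apply: integral_ge0 => x _; rewrite lee_fin mulr_ge0 ?powR_ge0.
Qed.
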